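(* Let $\mathcal{X}$ be a (real or complex) Banach space with $\dim \mathcal{X}\geq 2$, and let $\mathcal{N}$ be a nest on $\mathcal{X}$ such that each $N\in\mathcal{N}$ with $N_{-}=N$ is complemented in $\mathcal{X}$. Then every ternary derivation of $Alg\mathcal{N}$ is an inner ternary derivation.
   Context: A nest $\mathcal{N}$ on a Banach space $\mathcal{X}$ is a chain (under inclusion) of norm-closed subspaces of $\mathcal{X}$ containing $\{0\}$ and $\mathcal{X}$ such that for every family $\{N_i\}$ of elements of $\mathcal{N}$, both $\bigcap N_i$ and $\bigvee N_i$ (the closed linear span of the $N_i$) belong to $\mathcal{N}$. The nest algebra $Alg\mathcal{N}$ is the algebra of all bounded linear operators on $\mathcal{X}$ that leave every member of $\mathcal{N}$ invariant. For $N\in\mathcal{N}$, $N_{-}:=\bigvee\{M\in\mathcal{N} : M\subsetneq N\}$. A ternary derivation of an associative algebra $\mathcal{A}$ is a triple $(\gamma,\delta,\tau)$ of linear maps $\mathcal{A}\to\mathcal{A}$ such that $\gamma(ab)=\delta(a)b+a\tau(b)$ for all $a,b\in\mathcal{A}$. It is called an inner ternary derivation if there exist $a,b,c\in\mathcal{A}$ such that $(\gamma,\delta,\tau)=(L_a+R_b,\ L_a+R_c,\ -L_c+R_b)$, where $L_a(x):=ax$ and $R_b(x):=xb$ are the left and right multiplication operators on $\mathcal{A}$. Linear maps are linear over the scalar field of $\mathcal{X}$ and are not assumed continuous. *)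

(* Defs.v *)
From HB Require Import structures.
From mathcomp Require Import all_boot all_order all_algebra.
From mathcomp Require Import all_classical all_reals all_analysis.
From mathcomp Require Import complex.
Set Implicit Arguments.
Unset Strict Implicit.
Unset Printing Implicit Defensive.
Import Order.TTheory GRing.Theory Num.Theory.
Import numFieldNormedType.Exports.
Local Open Scope classical_set_scope.
Local Open Scope ring_scope.

Variant real_or_complex (R : realType) : numFieldType -> Prop :=
| RealScalars : real_or_complex R R
| ComplexScalars : real_or_complex R R[i].

(* The associative algebra is given by its module structure and its product,
   because the library's algType excludes the zero algebra. *)
Section TernaryDerivations.
Context {K : pzRingType} {A : lmodType K} (mul : A -> A -> A).

Definition lmul (a : A) : A -> A := fun x => mul a x.
Definition rmul (b : A) : A -> A := fun x => mul x b.

Definition ternary_derivation (gamma delta tau : {linear A -> A}) : Prop :=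
  forall a b : A, gamma (mul a b) = mul (delta a) b + mul a (tau b).

Definition inner_ternary_derivation (gamma delta tau : {linear A -> A}) : Prop :=
  exists a b c : A,
    [/\ gamma = lmul a \+ rmul b :> (A -> A),
        delta = lmul a \+ rmul c :> (A -> A)
      & tau = (\- lmul c) \+ rmul b :> (A -> A)].

End TernaryDerivations.

Definition dim_ge (K : numFieldType) (X : lmodType K) (n : nat) : Prop :=
  exists v : 'I_n -> X,
    forall k : 'I_n -> K, \sum_(i < n) k i *: v i = 0 -> forall i, k i = 0.

Section Nests.
Context {K : numFieldType} {X : normedModType K}.
Implicit Types M : set X.

Definition linear_subspace M : Prop :=
  M 0 /\ forall (k : K) (x y : X), M x -> M y -> M (k *: x + y).

Definition closed_subspace M : Prop := linear_subspace M /\ closed M.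

Definition closed_span (S : set X) : set X :=
  closure (smallest linear_subspace S).

Definition complemented M : Prop :=
  closed_subspace M /\
  exists2 M' : set X, closed_subspace M' &
    M `&` M' = [set 0] /\
    forall x, exists y z, [/\ M y, M' z & x = y + z].

(* [nest_bigcap] and [nest_bigjoin] range over arbitrary subfamilies F, given as
   sets of members of the nest; F may be empty. *)
Record nest := Nest {
  nest_mem :> set X -> Prop;
  nest_closed_subspace : forall M, nest_mem M -> closed_subspace M;
  nest_chain : total_on nest_mem subset;
  nest0 : nest_mem [set 0];
  nestT : nest_mem setT;
  nest_bigcap : forall F : set (set X),
    F `<=` nest_mem -> nest_mem (\bigcap_(M in F) M);
  nest_bigjoin : forall F : set (set X),
    F `<=` nest_mem -> nest_mem (closed_span (\bigcup_(M in F) M))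
}.

Definition nest_pred (N : nest) M : set X :=
  closed_span (\bigcup_(L in [set L | N L /\ L `<` M]) L).

Definition bounded_operator (f : X -> X) : Prop :=
  linear f /\ exists C : K, forall x, `|f x| <= C * `|x|.

Definition in_nest_alg (N : nest) : {pred X -> X} := fun f =>
  `[< bounded_operator f /\ forall M, N M -> forall x, M x -> M (f x) >].

Record nest_alg (N : nest) := NestAlg {
  nest_op :> X -> X;
  nest_opP : nest_op \in in_nest_alg N
}.

End Nests.
Arguments nest {K} X.

Section NestAlgebraStructure.
Context {K : numFieldType} {X : normedModType K} (N : nest X).

HB.instance Definition _ := [isSub for @nest_op K X N].
HB.instance Definition _ := [Choice of nest_alg N by <:].

Lemma in_nest_algP (f : X -> X) :
  reflect (bounded_operator f /\ forall M, N M -> forall x, M x -> M (f x))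
          (f \in in_nest_alg N).
Proof. exact: asboolP. Qed.

Lemma bounded_operator_pos (f : X -> X) : bounded_operator f ->
  exists2 C : K, 0 <= C & forall x, `|f x| <= C * `|x|.
Proof.
move=> [flin [C fC]].
have [X0|/existsNP[x /eqP x0]] := pselect (forall x : X, x = 0).
  by exists 0 => // x; rewrite (X0 (f x)) normr0 mul0r.
exists C => //; rewrite -(pmulr_lge0 _ (_ : 0 < `|x|)) ?normr_gt0 //.
by rewrite (le_trans (normr_ge0 (f x)) (fC x)).
Qed.

Lemma in_nest_alg_submod_closed : submod_closed (in_nest_alg N).
Proof.
split.
  apply/in_nest_algP; split; first split.
  - by move=> k x y /=; rewrite /GRing.zero /= scaler0 addr0.
  - by exists 0 => x; rewrite normr0 mul0r.
  - by move=> M /nest_closed_subspace[[]].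
move=> k f g /in_nest_algP[[flin [C fC]] fN] /in_nest_algP[[glin [D gD]] gN].
apply/in_nest_algP; split; first split.
- move=> a x y.
  rewrite !(scalrfctE, addrfctE) flin glin !scalerDr !scalerA (mulrC k a).
  by rewrite addrACA.
- exists (`|k| * C + D) => x; rewrite mulrDl (le_trans (ler_normD _ _))//.
  by rewrite lerD// normrZ -mulrA ler_wpM2l.
- move=> M NM x Mx; have [[_ sM] _] := nest_closed_subspace NM.
  by apply: sM; [exact: fN|exact: gN].
Qed.

HB.instance Definition _ :=
  GRing.isSubmodClosed.Build K (X -> X) (in_nest_alg N)
    in_nest_alg_submod_closed.
HB.instance Definition _ := [SubChoice_isSubLmodule of nest_alg N by <:].

Lemma id_in_nest_alg : idfun \in in_nest_alg N.
Proof.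
by apply/in_nest_algP; split => //; split => //; exists 1 => x; rewrite mul1r.
Qed.

Lemma comp_in_nest_alg (f g : nest_alg N) : (f \o g) \in in_nest_alg N.
Proof.
have /in_nest_algP[fb fN] := nest_opP f.
have /in_nest_algP[[glin [D gD]] gN] := nest_opP g.
have [C C0 fC] := bounded_operator_pos fb; have [flin _] := fb.
apply/in_nest_algP; split; first split.
- by move=> k x y /=; rewrite glin flin.
- exists (C * D) => x /=; rewrite (le_trans (fC _))// -mulrA.
  by rewrite ler_wpM2l.
- by move=> M NM x Mx /=; apply: fN => //; exact: gN.
Qed.

Definition nest_alg_one : nest_alg N := NestAlg id_in_nest_alg.
Definition nest_alg_mul (f g : nest_alg N) : nest_alg N :=
  NestAlg (comp_in_nest_alg f g).

Lemma nest_alg_ext (f g : nest_alg N) : (forall x, f x = g x) -> f = g.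
Proof. by move=> fg; apply: val_inj; apply: funext. Qed.

Lemma nest_alg_linear (f : nest_alg N) : linear f.
Proof. by have /in_nest_algP[[]] := nest_opP f. Qed.

HB.instance Definition _ (f : nest_alg N) :=
  GRing.isLinear.Build K X X *:%R f (nest_alg_linear f).

Lemma nest_alg_addE (f g : nest_alg N) x : (f + g) x = f x + g x.
Proof. by []. Qed.

Lemma nest_alg_scaleE (k : K) (f : nest_alg N) x : (k *: f) x = k *: f x.
Proof. by []. Qed.

Let mulA : associative nest_alg_mul.
Proof. by move=> f g h; exact: nest_alg_ext. Qed.
Let mul1 : left_id nest_alg_one nest_alg_mul.
Proof. by move=> f; exact: nest_alg_ext. Qed.
Let mulr1 : right_id nest_alg_one nest_alg_mul.
Proof. by move=> f; exact: nest_alg_ext. Qed.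
Let mulDl : left_distributive nest_alg_mul +%R.
Proof. by move=> f g h; exact: nest_alg_ext. Qed.
Let mulDr : right_distributive nest_alg_mul +%R.
Proof.
move=> f g h; apply: nest_alg_ext => x.
exact: (linearD f (g x) (h x)).
Qed.

HB.instance Definition _ :=
  GRing.Zmodule_isPzRing.Build (nest_alg N) mulA mul1 mulr1 mulDl mulDr.

Lemma nest_alg_mulE (f g : nest_alg N) x : (f * g) x = f (g x).
Proof. by []. Qed.

Lemma nest_alg_scalerAl (k : K) (f g : nest_alg N) : k *: (f * g) = (k *: f) * g.
Proof. exact: nest_alg_ext. Qed.

Lemma nest_alg_scalerAr (k : K) (f g : nest_alg N) : k *: (f * g) = f * (k *: g).
Proof.
apply: nest_alg_ext => x.
rewrite nest_alg_scaleE !nest_alg_mulE nest_alg_scaleE.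
by rewrite linearZ.
Qed.

End NestAlgebraStructure.
Arguments nest_alg_mul {K X N} f g.
Arguments nest_alg_one {K X N}.

(* Main.v *)
From HB Require Import structures.
Require Import Defs.
From mathcomp Require Import all_boot all_order all_algebra.
From mathcomp Require Import all_classical all_reals all_analysis.
From mathcomp Require Import complex ring.
Set Implicit Arguments.
Unset Strict Implicit.
Unset Printing Implicit Defensive.
Import Order.TTheory GRing.Theory Num.Theory numFieldNormedType.Exports.
Local Open Scope classical_set_scope.
Local Open Scope ring_scope.

(** A ternary derivation of a unital ring is an ordinary derivation in disguise:
    [D a = delta a - delta 1 * a] is a derivation, and if [D] is the commutator
    with some [t], then [delta 1], [tau 1] and [t] give the three multipliers
    ([ternary_derivation_part], [ternary_derivation_of_commutator]). So the point
    is that every linear derivation [D] of a nest algebra is a commutator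
    ([derivation_inner]).

    Write [x ⊗ f] for the operator [y |-> f y *: x]. It lies in the nest algebra
    as soon as [x] belongs to a member [L] of the nest and [f] kills the
    predecessor [L_-] ([rank_oneE]). If [L_- <> X], the Hahn-Banach theorem gives
    such an [f] with [f x0 = 1] for some [x0]; evaluating at [x0] the derivation
    rule for [a * (x ⊗ f) = a x ⊗ f] shows that [T x = D (x ⊗ f) x0] satisfies
    [D a = T a - a T] on [L] ([local_implementation]). These [L] form a chain with
    dense union ([local_domain_dense]), so it remains to glue the operators [T].

    The obstacle is that the norms of the local operators could be unbounded along
    the chain. They are not, because [D] is automatically continuous: the nest
    algebra is a Banach space, the graph of [D] is closed since enough of the
    functionals [a |-> g (D a y)] are continuous to separate points
    ([derivation_closable]), and the closed graph theorem applies
    ([derivation_bounded]). Choosing [f] and [x0] almost norm one then bounds every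
    local [T] by twice the bound of [D].

    Two local operators differ by an operator commuting with all rank-one members
    of the algebra, hence by a scalar. Requiring [g (T y0) = 0] for one fixed
    vector [y0] and functional [g] removes this freedom ([commutant_vanish]), so
    the normalised operators agree on common domains and extend to one bounded
    operator on [X] ([global_implementation]). It leaves the nest invariant: if
    [y] is in [M], testing [D] on rank-one operators shows that [T y] is in [L_-]
    for each [L] strictly above [M], and such vectors are in [M]
    ([mem_nest_of_preds], [implementation_mem]).

    The real and the complex case are treated together through an embedding
    [inj] of the reals in the scalars and a real part [re] ([real_form]); norms
    and the Hahn-Banach and Baire theorems are used over the reals. *)

(** * The Hahn-Banach theorem *)

Section HahnBanach.
Context {R : realType} {V : lmodType R}.
Implicit Types (p q : V -> R).

Definition sublinear p : Prop :=
  (forall x y, p (x + y) <= p x + p y) /\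
  (forall (r : R) x, 0 <= r -> p (r *: x) = r * p x).

Lemma sublinear0 p : sublinear p -> p 0 = 0.
Proof. by move=> [_ pZ]; rewrite -(scale0r 0) pZ// mul0r. Qed.

Lemma sublinear_geN p x : sublinear p -> - p (- x) <= p x.
Proof.
move=> sp; have := sp.1 x (- x).
by rewrite subrr sublinear0// -lerBlDr sub0r.
Qed.

Lemma sublinearI p : p 0 = 0 -> (forall x y, p (x + y) <= p x + p y) ->
  (forall (r : R) x, 0 < r -> p (r *: x) <= r * p x) -> sublinear p.
Proof.
move=> p0 pD pZ; split=> // r x; rewrite le_eqVlt => /predU1P[<-|r0].
  by rewrite scale0r p0 mul0r.
apply/eqP; rewrite eq_le pZ//= -ler_pdivlMl//.
by rewrite -{1}(scalerK (lt0r_neq0 r0) x) pZ ?invr_gt0.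
Qed.

Lemma le_inf_add (A B : set R) c : A !=set0 -> B !=set0 ->
  (forall a b, A a -> B b -> c <= a + b) -> c <= inf A + inf B.
Proof.
move=> A0 B0 cAB; rewrite -lerBlDr; apply: lb_le_inf => // a Aa.
rewrite lerBlDr addrC -lerBlDr; apply: lb_le_inf => // b Bb.
by rewrite lerBlDr addrC cAB.
Qed.

Lemma le_inf_mul (A B : set R) r : 0 < r -> B !=set0 -> has_lbound A ->
  (forall b, B b -> exists2 a, A a & a <= r * b) -> inf A <= r * inf B.
Proof.
move=> r0 B0 Alb AB; rewrite -ler_pdivrMl//; apply: lb_le_inf => // b /AB[a Aa ab].
by rewrite ler_pdivrMl//; apply: le_trans ab; apply: ge_inf.
Qed.

(** The witness is the largest sublinear function below [p] with this value bound
    at [- v]; on the line of [v] it is linear and touches [p] at [v]. It serves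
    both to show that minimal sublinear functions are odd and to make a linear
    minorant touch [p] at a prescribed vector. *)
Lemma sublinear_tilt p v : sublinear p -> exists q,
  [/\ sublinear q, forall x, q x <= p x & q (- v) <= - p v].
Proof.
move=> sp; have [pD pZ] := sp.
pose E (x : V) := [set p (x + t *: v) - t * p v | t in [set t : R | 0 <= t]].
have E0 x : E x !=set0 by exists (p (x + 0 *: v) - 0 * p v), 0 => /=.
have lbE x : lbound (E x) (- p (- x)).
  move=> _ [t t0 <-]; rewrite -pZ// lerBrDr addrC lerBlDr.
  by rewrite -{1}(addKr x (t *: v)) addrC.
have hlb x : has_lbound (E x) by exists (- p (- x)); exact: lbE.
have qp x : inf (E x) <= p x.
  by apply: ge_inf => //; exists 0 => /=; rewrite // scale0r mul0r addr0 subr0.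
exists (fun x => inf (E x)); split=> //.
- apply: sublinearI.
  + apply/eqP; rewrite eq_le (le_trans (qp 0)) ?sublinear0//=.
    by apply: lb_le_inf => // z /lbE; rewrite oppr0 sublinear0// oppr0.
  + move=> x y; apply: le_inf_add => // _ _ [t t0 <-] [s s0 <-].
    apply: (@le_trans _ _ (p (x + y + (t + s) *: v) - (t + s) * p v)).
      by apply: ge_inf => //; exists (t + s) => //=; rewrite addr_ge0.
    rewrite mulrDl opprD addrACA lerD2r scalerDl addrACA; exact: pD.
  + move=> r x r0; apply: le_inf_mul => // _ [t t0 <-].
    exists (p (r *: x + (r * t) *: v) - (r * t) * p v).
      by exists (r * t) => //=; rewrite mulr_ge0// ltW.
    by rewrite -scalerA -scalerDr (pZ _ _ (ltW r0)) mulrBr mulrA.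
- apply: ge_inf => //; exists 1 => //=.
  by rewrite scale1r addNr sublinear0// mul1r sub0r.
Qed.

Lemma sublinear_odd_scalar p :
  sublinear p -> (forall x, p (- x) <= - p x) -> scalar p.
Proof.
move=> sp pN; have [pD pZ] := sp.
have pNE x : p (- x) = - p x.
  by apply/eqP; rewrite eq_le pN/= lerNl sublinear_geN.
have pDE x y : p (x + y) = p x + p y.
  apply/eqP; rewrite eq_le pD/= -[x + y]opprK pNE lerNr.
  by rewrite [- (p x + _)]opprD -!pNE opprD pD.
move=> r x y; rewrite pDE; congr (_ + _).
have [r0|r0] := leP 0 r; first by rewrite pZ.
by rewrite -[r]opprK scaleNr pNE pZ ?mulNr// oppr_ge0 ltW.
Qed.

(** A minimal sublinear function below [p] cannot be lowered by a tilt, so it is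
    odd, and an odd sublinear function is linear. Starting below the tilt of [p]
    along [v] forces the value at [v]. *)
Theorem hahn_banach p v : sublinear p -> exists u : V -> R,
  [/\ scalar u, forall x, u x <= p x & u v = p v].
Proof.
move=> /(sublinear_tilt v)[p1 [sp1 p1p p1v]].
pose T := {q : V -> R | sublinear q /\ forall x, q x <= p1 x}.
pose mkT q (qP : sublinear q /\ forall x, q x <= p1 x) : T := exist _ q qP.
pose rel_T (q1 q2 : T) := `[< forall x, sval q2 x <= sval q1 x >].
have [||||[q [sq qp1]] qmin] := @Zorn T rel_T.
- by move=> q; apply/asboolP.
- move=> q1 q2 q3 /asboolP q12 /asboolP q23; apply/asboolP => x.
  exact: le_trans (q12 x).
- move=> [q1 q1P] [q2 q2P] /asboolP/= q12 /asboolP/= q21.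
  have q12E : q1 = q2 by apply/funext => x; apply/eqP; rewrite eq_le q12 q21.
  by case: _ / q12E in q2P *; congr exist; exact: Prop_irrelevance.
- move=> A Atot; have [[q0 Aq0]|A0] := pselect (A !=set0); last first.
    have spp : sublinear p1 /\ forall x, p1 x <= p1 x by [].
    by exists (mkT _ spp) => s As; case: A0; exists s.
  pose E (x : V) := [set sval q x | q in A].
  have E0 x : E x !=set0 by exists (sval q0 x), q0.
  have lbE x : lbound (E x) (- p1 (- x)).
    move=> _ [[q /= [sq qp]] Aq <-]; apply: le_trans (sublinear_geN _ sq).
    by rewrite lerN2.
  have hlb x : has_lbound (E x) by exists (- p1 (- x)); exact: lbE.
  have qE (q : T) x : A q -> inf (E x) <= sval q x.
    by move=> Aq; apply: ge_inf => //; exists q.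
  (* The infimum of a chain of sublinear functions is sublinear: the bounds
     below come from [q (- x)], and subadditivity is checked on the smaller of
     two members. *)
  have sE : sublinear (fun x => inf (E x)) /\ forall x, inf (E x) <= p1 x.
    split; last first.
      by move=> x; apply: le_trans (qE _ x Aq0) _; case: q0 {Aq0} => q [].
    apply: sublinearI.
    + apply/eqP; rewrite eq_le; apply/andP; split.
        by apply: le_trans (qE _ _ Aq0) _; rewrite sublinear0//; case: (q0) => ? [].
      by apply: lb_le_inf => // z /lbE; rewrite oppr0 sublinear0// oppr0.
    + move=> x y; apply: le_inf_add => // _ _ [q1 Aq1 <-] [q2 Aq2 <-].
      have [q12|q21] := Atot _ _ Aq1 Aq2.
        move/asboolP: q12 => q12.
        apply: le_trans (qE _ _ Aq2) _.
        apply: le_trans (_ : sval q2 x + sval q2 y <= _); last by rewrite lerD2r.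
        by case: (q2) => ? [[]].
      move/asboolP: q21 => q21.
      apply: le_trans (qE _ _ Aq1) _.
      apply: le_trans (_ : sval q1 x + sval q1 y <= _); last by rewrite lerD2l.
      by case: (q1) => ? [[]].
    + move=> r x r0; apply: le_inf_mul => // _ [q1 Aq1 <-].
      exists (sval q1 (r *: x)); first by exists q1.
      by case: (q1) => ? [[_ /= ->]]//; exact: ltW.
  by exists (mkT _ sE) => q Aq; apply/asboolP => x /=; exact: qE.
have qodd x : q (- x) <= - q x.
  have [q' [sq' q'q q'x]] := sublinear_tilt x sq.
  have q'p : sublinear q' /\ forall x, q' x <= p1 x.
    by split=> // y; exact: le_trans (q'q y) (qp1 y).
  have q'E := qmin (mkT _ q'p) (asboolT q'q).
  have q'_eq : q' = q := congr1 (@sval _ _) q'E.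
  by rewrite -{1}q'_eq.
exists q; split; first exact: sublinear_odd_scalar.
  by move=> x; exact: le_trans (qp1 x) (p1p x).
apply/eqP; rewrite eq_le (le_trans (qp1 v))//=.
by apply: le_trans (sublinear_geN v sq); rewrite lerNr (le_trans (qp1 _)).
Qed.

End HahnBanach.

(** * Real and complex scalars *)

(** What the proof needs to know about the scalars: [inj] embeds the reals, [re]
    is a real part, and every real-linear functional is the real part of a linear
    one. *)
Record real_form (R : realType) (K : numFieldType)
    (inj : {rmorphism R -> K}) (re : K -> R) : Prop := RealForm {
  re_injM : forall r z, re (inj r * z) = r * re z;
  re_ge0K : forall z, 0 <= z -> inj (re z) = z;
  real_inj_le : {mono inj : r s / r <= s};
  re_le_norm : forall z, re z <= re `|z|;
  re_lift : forall (X : lmodType K) (u : X -> R),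
    (forall r x y, u (inj r *: x + y) = r * u x + u y) ->
    exists2 f : X -> K, scalar f & forall x, re (f x) = u x
}.

(** In the complex case the functional with real part [u] is
    [x |-> u x - i u (i x)]. *)
Lemma real_or_complex_form (R : realType) (K : numFieldType) :
  real_or_complex R K -> exists inj re, @real_form R K inj re.
Proof.
case.
  exists idfun, idfun; split=> //=; first exact: ler_norm.
  by move=> X u ul; exists u.
exists (real_complex R), (@complex.Re R); split.
- by move=> r [a b] /=; rewrite mul0r subr0.
- by move=> z z0; exact: RRe_real (ger0_real z0).
- by move=> r s; rewrite lecR.
- move=> [a b]; rewrite normc_def /= (le_trans (ler_norm a))//.
  by rewrite -sqrtr_sqr ler_wsqrtr// lerDl sqr_ge0.
move=> X u ul.
have uD x y : u (x + y) = u x + u y.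
  by have := ul 1 x y; rewrite rmorph1 scale1r mul1r.
have u0 : u 0 = 0 by apply: (addrI (u 0)); rewrite -uD !addr0.
have uZ r x : u (r%:C%C *: x) = r * u x.
  by have := ul r x 0; rewrite !addr0 u0 addr0.
exists (fun x => (u x +i* (- u ('i%C *: x)))%C); last by [].
move=> [a b] x y.
have uC z : u ((a +i* b)%C *: z) = a * u z + b * u ('i%C *: z).
  rewrite (_ : (a +i* b)%C = a%:C%C + b%:C%C * 'i%C :> R[i]); last first.
    by rewrite mulrC; exact: (complexE (a +i* b)%C).
  by rewrite scalerDl -scalerA uD !uZ.
have ii : 'i%C * 'i%C = - 1 :> R[i] by rewrite -expr2 sqr_i.
have uN z : u (- 1 *: z) = - u z.
  by have := uZ (- 1) z; rewrite rmorphN1 mulN1r.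
rewrite /= scalerDr !uD scalerA (mulrC 'i%C) -scalerA !uC scalerA ii uN.
by apply/eqP; rewrite eq_complex /=; apply/andP; split; apply/eqP; ring.
Qed.

(** * Separation of points from closed subspaces *)

(** The argument [inj] is kept in the type so that restriction of scalars along it
    can be declared as the module structure. *)
Definition realified (R : pzRingType) (K : pzRingType) (inj : {rmorphism R -> K})
  (X : Type) : Type := X.

Section Realified.
Context {R K : pzRingType} (inj : {rmorphism R -> K}) (X : lmodType K).

HB.instance Definition _ := GRing.Zmodule.on (realified inj X).

Let scale (r : R) (x : realified inj X) : realified inj X := inj r *: (x : X).

Fact realified_scalerA r s x : scale r (scale s x) = scale (r * s) x.
Proof. by rewrite /scale scalerA rmorphM. Qed.
Fact realified_scale1r : left_id 1 scale.
Proof. by move=> x; rewrite /scale rmorph1 scale1r. Qed.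
Fact realified_scalerDr : right_distributive scale +%R.
Proof. by move=> r x y; rewrite /scale scalerDr. Qed.
Fact realified_scalerDl x : {morph scale^~ x : r s / r + s}.
Proof. by move=> r s; rewrite /scale rmorphD scalerDl. Qed.

HB.instance Definition _ := GRing.Zmodule_isLmodule.Build R (realified inj X)
  realified_scalerA realified_scale1r realified_scalerDr realified_scalerDl.

End Realified.

Section Separation.
Context {R : realType} {K : numFieldType}.
Context {inj : {rmorphism R -> K}} {re : K -> R} (KP : real_form inj re).

Lemma injK : cancel inj re.
Proof.
have re1 : re 1 = 1.
  apply: (fmorph_inj inj).
  by rewrite (re_ge0K KP ler01) rmorph1.
by move=> r; rewrite -[inj r]mulr1 (re_injM KP) re1 mulr1.
Qed.

Lemma inj_ge0 r : (0 <= inj r) = (0 <= r).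
Proof. by rewrite -(rmorph0 inj) (real_inj_le KP). Qed.

Lemma inj_gt0 r : (0 < inj r) = (0 < r).
Proof. by rewrite !lt0r inj_ge0 fmorph_eq0. Qed.

Lemma inj_norm r : `|inj r| = inj `|r|.
Proof.
have [r0|r0] := leP 0 r; first by rewrite ger0_norm ?inj_ge0 // ger0_norm.
have injr0 : inj r < 0 by rewrite -oppr_gt0 -rmorphN inj_gt0 oppr_gt0.
by rewrite (ltr0_norm injr0) (ltr0_norm r0) rmorphN.
Qed.

Context {X : normedModType K}.
Implicit Types x y z : X.

Lemma inj_rnorm x : inj (re `|x|) = `|x|.
Proof. by rewrite (re_ge0K KP). Qed.

Lemma rnorm_le x r : (re `|x| <= r) = (`|x| <= inj r).
Proof. by rewrite -(real_inj_le KP) inj_rnorm. Qed.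

Lemma rnorm_ge0 x : 0 <= re `|x|.
Proof. by rewrite -inj_ge0 inj_rnorm. Qed.

Lemma rnormD x y : re `|x + y| <= re `|x| + re `|y|.
Proof. by rewrite rnorm_le rmorphD/= !inj_rnorm ler_normD. Qed.

Lemma rnormZ (k : K) x : re `|k *: x| = re `|k| * re `|x|.
Proof. by rewrite normrZ -{1}(re_ge0K KP (normr_ge0 k)) (re_injM KP). Qed.

Lemma rnorm_eq0 x : (re `|x| == 0) = (x == 0).
Proof. by rewrite -(fmorph_eq0 inj) inj_rnorm normr_eq0. Qed.

Lemma closed_notin_dist (L : set X) x : closed L -> ~ L x ->
  exists2 e : R, 0 < e & forall z, L z -> e <= re `|x - z|.
Proof.
move=> Lc Lx.
have : nbhs x (~` L) by apply: open_nbhs_nbhs; split => //; exact: closed_openC.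
move=> /nbhs_normP[e /= e0 eL]; exists (re e).
  by rewrite -inj_gt0 (re_ge0K KP) // ltW.
move=> z Lz; rewrite leNgt; apply/negP => xze; apply: (eL z) => //=.
have : inj (re `|x - z|) < inj (re e).
  by rewrite lt_neqAle (real_inj_le KP) (ltW xze) andbT (inj_eq (fmorph_inj _)) lt_eqF.
by rewrite inj_rnorm (re_ge0K KP (ltW e0)).
Qed.

(** Hahn-Banach for the distance [p] to [L], scaled so that the value at [x0] is
    [1]. Replacing [v] by [x0 = v - m] with [m] almost nearest to [v] in [L] makes
    the pair norming up to the factor [2]; this uniform constant is what later
    bounds all local implementations at once. *)
Lemma closed_subspace_separation (L : set X) v : closed_subspace L -> ~ L v ->
  exists (f : X -> K) (x0 : X), [/\ scalar f, forall z, L z -> f z = 0,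
    L (v - x0), f x0 = 1 & forall x, `|f x| * `|x0| <= 2 * `|x|].
Proof.
move=> [[L0 Llin] Lc] Lv.
have LD x y : L x -> L y -> L (x + y).
  by move=> Lx Ly; have := Llin 1 _ _ Lx Ly; rewrite scale1r.
have LZ k x : L x -> L (k *: x).
  by move=> Lx; have := Llin k _ _ Lx L0; rewrite addr0.
pose E x := [set re `|x - m| | m in L].
pose p x := inf (E x).
have E0 x : E x !=set0 by exists (re `|x - 0|), 0.
have lbE x : lbound (E x) 0 by move=> _ [m _ <-]; exact: rnorm_ge0.
have hlb x : has_lbound (E x) by exists 0; exact: lbE.
have p_ge0 x : 0 <= p x by apply: lb_le_inf.
have p_le x m : L m -> p x <= re `|x - m|.
  by move=> Lm; apply: ge_inf => //; exists m.
have pZ1 (k : K) x : `|k| = 1 -> p (k *: x) <= p x.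
  move=> k1; apply: lb_le_inf => // _ [m Lm <-].
  apply: le_trans (p_le _ _ (LZ k _ Lm)) _.
  by rewrite -scalerBr normrZ k1 mul1r.
pose pR : realified inj X -> R := p.
have sp : sublinear pR.
  apply: sublinearI.
  - apply/eqP; rewrite eq_le p_ge0 andbT (le_trans (p_le _ _ L0))//.
    by rewrite subr0 le_eqVlt rnorm_eq0 eqxx.
  - move=> x y; apply: le_inf_add => // _ _ [m Lm <-] [n Ln <-].
    apply: le_trans (p_le _ _ (LD _ _ Lm Ln)) _.
    by rewrite opprD addrACA rnormD.
  - move=> r x r0; apply: le_inf_mul => // _ [m Lm <-].
    exists (re `|inj r *: (x : X) - inj r *: m|).
      by exists (inj r *: m) => //; exact: LZ.
    by rewrite -scalerBr rnormZ inj_norm injK gtr0_norm.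
have [u [ul up uv]] := hahn_banach (v : realified inj X) sp.
have [f flin fu] := re_lift KP (X := X) (u := u) ul.
have f0 : f 0 = 0.
  by have := flin (- 1) 0 0; rewrite scaler0 addr0 mulN1r addNr.
(* Rotating [x] by a scalar of modulus one makes [f x] real and positive. *)
have f_le x : `|f x| <= inj (p x).
  have [->|fx0] := eqVneq (f x) 0; first by rewrite normr0 inj_ge0.
  pose k := `|f x| / f x.
  have k1 : `|k| = 1 by rewrite normrM normfV normr_id divff ?normr_eq0.
  rewrite -(re_ge0K KP (normr_ge0 (f x))) (real_inj_le KP).
  have <- : f (k *: x) = `|f x|.
    by have := flin k x 0; rewrite !addr0 => ->; rewrite f0 addr0 divfK.
  rewrite fu; apply: le_trans (up _) _; exact: pZ1.
have fL m : L m -> f m = 0.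
  move=> Lm; apply/eqP; rewrite -normr_eq0 eq_le normr_ge0 andbT.
  apply: le_trans (f_le m) _; rewrite -(rmorph0 inj) (real_inj_le KP).
  by apply: le_trans (p_le _ _ Lm) _; rewrite subrr le_eqVlt rnorm_eq0 eqxx.
have pv0 : 0 < p v.
  have [e e0 eL] := closed_notin_dist Lc Lv; apply: lt_le_trans e0 _.
  by apply: lb_le_inf => // _ [m Lm <-]; exact: eL.
have pfv : inj (p v) <= `|f v|.
  rewrite -(re_ge0K KP (normr_ge0 (f v))) (real_inj_le KP).
  by apply: le_trans (re_le_norm KP _); rewrite fu uv.
have fv0 : 0 < `|f v| by apply: lt_le_trans pfv; rewrite inj_gt0.
have [_ [m Lm <-] vm] : exists2 y, E v y & y < 2 * p v.
  by apply: inf_lt => //; rewrite ltr_pMl// ltr1n.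
exists (fun x => (f v)^-1 * f x), (v - m); split.
- by move=> k x y; rewrite flin mulrDr mulrCA.
- by move=> z Lz; rewrite (fL _ Lz) mulr0.
- by rewrite opprB addrCA subrr addr0.
- have := flin (- 1) m v; rewrite scaleN1r (addrC v) => ->.
  by rewrite (fL _ Lm) mulr0 add0r mulVf// -normr_gt0.
- move=> x; rewrite normrM normfV -mulrA ler_pdivrMl//.
  apply: (@le_trans _ _ (inj (p x) * inj (2 * p v))).
    by apply: ler_pM => //; rewrite -rnorm_le ltW.
  rewrite rmorphM rmorph_nat mulrCA [leRHS]mulrCA ler_pM2l// mulrC.
  apply: ler_pM => //; rewrite ?inj_ge0 ?p_ge0//.
  by rewrite -inj_rnorm (real_inj_le KP) -{2}(subr0 x) p_le.
Qed.
End Separation.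

(** * The closed graph theorem *)

Section ClosedGraph.
Context {R : realType} {V W : completeNormedModType R} (T : {linear V -> W}).

(** The sets where [T] is bounded by an integer cover [V], so by Baire one of their
    closures contains a ball; differences of its points fill a ball around [0]. *)
Lemma dense_bounded_image : exists C r : R, 0 < r /\
  forall x, `|x| < r -> forall e, 0 < e ->
    exists y, `|T y| <= C /\ `|x - y| < e.
Proof.
pose F n := closure [set x | `|T x| <= n%:R].
have [n /denseNE[U [[u Uu] FU]]] : exists n, ~ dense (~` F n).
  apply/existsNP => Fdense.
  have /(_ setT) : dense (\bigcap_n ~` F n).
    apply: Baire => n; split=> //; apply: closed_openC; exact: closed_closure.
  case; [by exists 0|exact: openT|].
  move=> x [_ Fx]; apply: (Fx (Num.truncn `|T x|).+1 I).
  by apply: subset_closure => /=; rewrite ltW// truncnS_gt.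
have [r /= r0 urF] : exists2 r : R, 0 < r & forall x, `|u - x| < r -> F n x.
  have /nbhs_normP[r r0 ur] := open_nbhs_nbhs Uu.
  exists r => // x xr; apply: contrapT => nFx.
  have : (U `&` ~` F n) x by split=> //; exact: ur.
  by rewrite FU.
exists (n%:R + n%:R), r; split=> // x xr e e0.
have approx z : `|u - z| < r -> exists2 y, `|T y| <= n%:R & `|z - y| < e / 2.
  have e20 : 0 < e / 2 by rewrite divr_gt0.
  by move=> /urF/(_ _ (nbhsx_ballx z _ e20))[y [Ty]]; rewrite -ball_normE; exists y.
have [|a Ta ua] := approx (u + x).
  by rewrite opprD addrA subrr sub0r normrN.
have [|b Tb ub] := approx u; first by rewrite subrr normr0.
exists (a - b); split.
  by rewrite linearB (le_trans (ler_normB _ _))// lerD.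
rewrite (_ : x - (a - b) = (u + x - a) - (u - b)).
  by rewrite (le_lt_trans (ler_normB _ _))// (splitr e) ltrD.
by rewrite !opprB addrA -(addrA u) [u + _]addrC -[RHS]addrA (addrCA u) subrr addr0 addrAC.
Qed.

(** The hypothesis says that the closure of the graph contains no [(0, y)] with
    [y <> 0]. Each [x] in a small ball is a sum of a geometrically decreasing series
    of vectors on which [T] is controlled, and closability identifies [T x] with the
    sum of the images. *)
Theorem closed_graph :
  (forall y, (forall e : R, 0 < e -> exists x, `|x| < e /\ `|y - T x| < e) ->
    y = 0) ->
  exists2 C : R, 0 <= C & forall x, `|T x| <= C * `|x|.
Proof.
move=> Tclosed; have [C [r [r0 approx]]] := dense_bounded_image.
have C0 : 0 <= C.
  have [|y [Ty _]] := approx 0 _ 1 ltr01; first by rewrite normr0.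
  exact: le_trans Ty.
have r20 : 0 < r / 2 by rewrite divr_gt0.
have /choice[a aP] : forall x, exists y, `|x| < r ->
    `|T y| <= C /\ `|x - y| < r / 2.
  move=> x; have [xr|] := pselect (`|x| < r); last by exists 0.
  by have [y Py] := approx x xr _ r20; exists y.
have Tr x : `|x| < r -> `|T x| <= C *+ 2.
  move=> xr.
  pose s n := iter n (fun x => 2 *: (x - a x)) x.
  have sr n : `|s n| < r.
    elim: n => //= n /aP[_ sa].
    by rewrite normrZ ger0_norm// -ltr_pdivlMl// mulrC.
  pose t : V^nat := fun n => 2^-1 ^+ n *: a (s n).
  (* [s n] is the remainder after [n] steps, rescaled to the size of [x]. *)
  have tE n : x - series t n = 2^-1 ^+ n *: s n.
    elim: n => [|n IH]; first by rewrite seriesEnat/= big_nil subr0 expr0 scale1r.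
    rewrite seriesSr opprD addrA IH /t -scalerBr /= scalerA exprSr.
    by rewrite -mulrA mulVf// mulr1.
  have Tt n : `|T (t n)| <= geometric C 2^-1 n.
    rewrite linearZ normrZ /= ger0_norm ?exprn_ge0// mulrC ler_wpM2r ?exprn_ge0//.
    by have [] := aP _ (sr n).
  have geo : series (geometric C 2^-1) @ \oo --> C *+ 2.
    have -> : C *+ 2 = C * (1 - 2^-1)^-1 by field.
    by apply: cvg_geometric_series; rewrite ger0_norm ?invf_lt1// ltr1n.
  have cvgT : cvgn [normed series (T \o t)].
    apply: (@series_le_cvg _ _ (geometric C 2^-1)) => //.
    - by move=> n /=.
    - by move=> n; apply: le_trans (Tt n).
    - exact: cvgP geo.
  pose y := limn (series (T \o t)).
  have yC : `|y| <= C *+ 2.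
    apply: le_trans (lim_series_norm cvgT) _; rewrite -(cvg_lim _ geo)//.
    by apply: lim_series_le => //; exact: cvgP geo.
  suff -> : T x = y by [].
  apply/eqP; rewrite -subr_eq0; apply/eqP; apply: Tclosed => e e0.
  have st0 : (2^-1 ^+ n *: s n) @[n --> \oo] --> (0 : V).
    apply: norm_cvg0.
    apply: (@squeeze_cvgr _ _ _ _ (cst 0) (geometric r 2^-1)).
    - apply: nearW => n; rewrite normr_ge0 normrZ ger0_norm ?exprn_ge0//=.
      by rewrite mulrC ler_wpM2r ?exprn_ge0// ltW.
    - exact: cvg_cst.
    - by apply: cvg_geometric; rewrite ger0_norm ?invf_lt1// ltr1n.
  have Ty : series (T \o t) @ \oo --> y by exact: normed_cvg.
  near \oo => n; exists (x - series t n); split.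
    by rewrite tE; near: n; move/cvgr0Pnorm_lt: st0; exact.
  rewrite linearB /= opprB addrC addrA subrK distrC.
  rewrite (_ : T (series t n) = series (T \o t) n); last by rewrite /series/= linear_sum.
  by near: n; move/cvgrPdist_lt: Ty; exact.
exists (C *+ 4 / r).
  by rewrite divr_ge0 ?mulrn_wge0// ltW.
move=> x; have [->|x0] := eqVneq x 0; first by rewrite linear0 !normr0 mulr0.
have k0 : 0 < r / 2 / `|x| by rewrite divr_gt0// normr_gt0.
have /Tr : `|(r / 2 / `|x|) *: x| < r.
  by rewrite normrZ gtr0_norm// divfK ?normr_eq0// ltr_pdivrMr// ltr_pMr// ltr1n.
rewrite linearZ normrZ gtr0_norm// -ler_pdivlMl//.
move/le_trans; apply; rewrite le_eqVlt; apply/orP; left; apply/eqP.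
field.
by rewrite normr_eq0 x0 gt_eqF.
Unshelve. all: by end_near. Qed.
End ClosedGraph.

(** * The nest algebra as a real Banach space *)

Lemma cvg_dist_le (K : numFieldType) (X : normedModType K) (T : Type)
    (F : set_system T) (FF : ProperFilter F) (u : T -> X) (l w : X) (c : K) :
  u @ F --> l -> (\forall t \near F, `|u t - w| <= c) -> `|l - w| <= c.
Proof.
move=> /cvgrPdist_lt ul uc; apply/ler_addgt0Pl => e /ul le.
have [t [tl tc]] := filter_ex (filterI le uc).
by rewrite -(subrKA (u t) l) (le_trans (ler_normD _ _))// lerD// ltW.
Qed.

Section OperatorNorm.
Context {R : realType} {K : numFieldType}.
Context {inj : {rmorphism R -> K}} {re : K -> R} (KP : real_form inj re).
Context {X : completeNormedModType K} {N : nest X}.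
Implicit Types (a b : nest_alg N) (C r : R).

(** The infimum over admissible constants is attained ([opnormP]), which spares
    normalising vectors; it is real even when the scalars are complex. *)
Definition opnorm a : R :=
  inf [set C | 0 <= C /\ forall x, `|a x| <= inj C * `|x|].

Let opnorm_lb a :
  has_lbound [set C | 0 <= C /\ forall x, `|a x| <= inj C * `|x|].
Proof. by exists 0 => C []. Qed.

Lemma opnorm_le a C :
  0 <= C -> (forall x, `|a x| <= inj C * `|x|) -> opnorm a <= C.
Proof. by move=> C0 aC; apply: ge_inf. Qed.

Let opnorm_set0 a :
  [set C | 0 <= C /\ forall x, `|a x| <= inj C * `|x|] !=set0.
Proof.
have /in_nest_algP[/bounded_operator_pos[C C0 aC] _] := nest_opP a.
by exists (re C); split; rewrite ?(re_ge0K KP)// -(inj_ge0 KP) (re_ge0K KP).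
Qed.

Lemma opnorm_ge0 a : 0 <= opnorm a.
Proof. by apply: lb_le_inf => // C []. Qed.

Lemma opnormP a x : `|a x| <= inj (opnorm a) * `|x|.
Proof.
have [->|x0] := eqVneq x 0; first by rewrite linear0 !normr0 mulr0.
have nx0 : 0 < re `|x| by rewrite lt0r (rnorm_eq0 KP) x0 (rnorm_ge0 KP).
rewrite -(inj_rnorm KP x) -(inj_rnorm KP (a x)) -rmorphM (real_inj_le KP).
rewrite -ler_pdivrMr//; apply: lb_le_inf => // C [C0 aC].
by rewrite ler_pdivrMr// -(real_inj_le KP) rmorphM !(inj_rnorm KP).
Qed.

Lemma opnormD a b : opnorm (a + b) <= opnorm a + opnorm b.
Proof.
apply: opnorm_le => [|x]; first by rewrite addr_ge0// opnorm_ge0.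
by rewrite rmorphD mulrDl (le_trans (ler_normD _ _))// lerD// opnormP.
Qed.

Let opnormZ_le C a : opnorm (inj C *: a) <= `|C| * opnorm a.
Proof.
apply: opnorm_le => [|x]; first by rewrite mulr_ge0// opnorm_ge0.
rewrite rmorphM nest_alg_scaleE normrZ (inj_norm KP) -mulrA.
by rewrite ler_wpM2l ?(inj_ge0 KP)// opnormP.
Qed.

Lemma opnormZ C a : opnorm (inj C *: a) = `|C| * opnorm a.
Proof.
apply/eqP; rewrite eq_le opnormZ_le/=.
have [->|C0] := eqVneq C 0; first by rewrite normr0 mul0r opnorm_ge0.
rewrite -ler_pdivlMl ?normr_gt0// -normfV; apply: le_trans (opnormZ_le _ _).
by rewrite scalerA -rmorphM mulVf// rmorph1 scale1r.
Qed.

Lemma opnorm_eq0 a : opnorm a = 0 -> a = 0.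
Proof.
move=> a0; apply: nest_alg_ext => x; apply/eqP; rewrite -normr_eq0 eq_le normr_ge0 andbT.
by have := opnormP a x; rewrite a0 rmorph0 mul0r.
Qed.

End OperatorNorm.
Arguments opnorm {R K} inj {X N} a.

(** The proof [KP] occurs in the type because the norm axioms depend on it. *)
Definition normed_nest_alg (R : realType) (K : numFieldType)
    (inj : {rmorphism R -> K}) (re : K -> R) (KP : real_form inj re)
    (X : completeNormedModType K) (N : nest X) : Type :=
  realified inj (nest_alg N).

Section NormedNestAlg.
Context {R : realType} {K : numFieldType}.
Context {inj : {rmorphism R -> K}} {re : K -> R} (KP : real_form inj re).
Context {X : completeNormedModType K} (N : nest X).
Local Notation A := (normed_nest_alg KP N).

HB.instance Definition _ :=
  GRing.Lmodule.copy A (realified inj (nest_alg N)).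
HB.instance Definition _ := @Lmodule_isNormed.Build R A (opnorm inj)
  (opnormD KP) (opnormZ KP) (opnorm_eq0 KP).

Lemma normed_nest_algE (a : A) : `|a| = opnorm inj (a : nest_alg N).
Proof. by []. Qed.

(** A Cauchy filter converges pointwise; the limit inherits linearity,
    boundedness and invariance of the members of the nest, which are closed. *)
Lemma normed_nest_alg_cauchy_cvg (F : set_system A) :
  ProperFilter F -> cauchy F -> cvg F.
Proof.
move=> FF /cauchyP Fc.
have Fnear e : 0 < e -> exists a0 : A, \forall t \near F,
    forall x : X, `|(t : nest_alg N) x - (a0 : nest_alg N) x| <= inj e * `|x|.
  move=> /Fc[a0 Fa0]; exists a0; apply: filterS Fa0 => t.
  rewrite -ball_normE /= distrC normed_nest_algE => /ltW te x.
  have := opnormP KP ((t : nest_alg N) - (a0 : nest_alg N)) x.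
  move=> /le_trans; apply; apply: ler_wpM2r => //.
  by rewrite (real_inj_le KP).
have /choice[l lP] x : exists l : X, (fun t : A => (t : nest_alg N) x) @ F --> l.
  apply/cvg_ex; apply: cauchy_cvg; apply: cauchy_exP => eps eps0.
  pose e := re eps / (re `|x| + 1).
  have x1 : 0 < re `|x| + 1 by rewrite ltr_wpDl// (rnorm_ge0 KP).
  have re0 : 0 < re eps by rewrite -(inj_gt0 KP) (re_ge0K KP)// ltW.
  have [a0 Fa0] := Fnear e (divr_gt0 re0 x1).
  exists ((a0 : nest_alg N) x); apply: filterS Fa0 => t /(_ x).
  rewrite -ball_normE /= distrC => /le_lt_trans; apply.
  rewrite -(re_ge0K KP (ltW eps0)) -(inj_rnorm KP x) -rmorphM.
  rewrite lt_neqAle (real_inj_le KP) (inj_eq (fmorph_inj _)) -lt_neqAle.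
  by rewrite /e -mulrAC ltr_pdivrMr// ltr_pM2l// ltrDl.
have lclose e (a0 : A) : (\forall t \near F,
      forall x : X, `|(t : nest_alg N) x - (a0 : nest_alg N) x| <= inj e * `|x|) ->
    forall x, `|l x - (a0 : nest_alg N) x| <= inj e * `|x|.
  by move=> Fa0 x; apply: cvg_dist_le (lP x) _; apply: filterS Fa0 => t; exact.
have lA : l \in in_nest_alg N.
  apply/in_nest_algP; split; first split.
  - move=> k x y; apply: norm_cvg_unique (lP _) _.
    rewrite (_ : (fun t : A => _) =
        (fun t : A => k *: (t : nest_alg N) x + (t : nest_alg N) y)).
      by apply: cvgD => //; apply: cvgZr.
    by apply/funext => t; rewrite (nest_alg_linear (t : nest_alg N)).
  - have [a0 /lclose la0] := Fnear 1 ltr01.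
    exists (1 + inj (opnorm inj (a0 : nest_alg N))) => x.
    rewrite -[l x](subrK ((a0 : nest_alg N) x)) mulrDl (le_trans (ler_normD _ _))//.
    apply: lerD; last exact: (opnormP KP).
    by rewrite -(rmorph1 inj).
  - move=> M NM x Mx; have [_ Mc] := nest_closed_subspace NM.
    apply: (closed_cvg _ Mc _ _ (lP x)); apply: nearW => t.
    by have /in_nest_algP[_] := nest_opP (t : nest_alg N); exact.
apply/cvg_ex; exists (NestAlg lA : A); apply/cvgrPdist_le => e e0.
have e20 : 0 < e / 2 by rewrite divr_gt0.
have [a0 Fa0] := Fnear _ e20; apply: filterS (Fa0) => t ta0.
apply: opnorm_le (ltW e0) _ => x; rewrite [e in inj e]splitr rmorphD mulrDl.
have -> : (((NestAlg lA : A) - t : A) : nest_alg N) x = l x - (t : nest_alg N) x by [].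
rewrite -(subrKA ((a0 : nest_alg N) x)) (le_trans (ler_normD _ _))// lerD//.
  exact: lclose.
by rewrite distrC.
Qed.

HB.instance Definition _ :=
  Uniform_isComplete.Build A normed_nest_alg_cauchy_cvg.

End NormedNestAlg.

(** * Annihilators, the order of the nest and rank-one operators *)

Section Annihilators.
Context {K : numFieldType} {X : normedModType K}.

Definition annihilator (L : set X) (f : X -> K) : Prop :=
  [/\ scalar f, exists c, forall x, `|f x| <= c * `|x| &
      forall z, L z -> f z = 0].

Lemma annihilatorB L f x y : annihilator L f -> f (x - y) = f x - f y.
Proof.
move=> [flin _ _]; have := flin (- 1) y x.
by rewrite scaleN1r mulN1r (addrC (- y)) (addrC (- f y)).
Qed.

Lemma annihilator_pos L f : annihilator L f ->
  exists2 c, 0 <= c & forall x, `|f x| <= c * `|x|.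
Proof.
move=> [flin [c fc] _]; exists `|c| => // x.
have cx0 : 0 <= c * `|x| := le_trans (normr_ge0 _) (fc x).
by rewrite (le_trans (fc x))// -[leLHS]ger0_norm// normrM normr_id.
Qed.

Lemma bounded_operator_vanish (S : set X) (f : X -> X) :
  bounded_operator f -> closure S = setT -> (forall z, S z -> f z = 0) ->
  forall x, f x = 0.
Proof.
move=> fb ST fS x; have [C C0 fC] := bounded_operator_pos fb; have [flin _] := fb.
apply/eqP; apply: contraT => fx0.
have C1 : 0 < C + 1 by rewrite ltr_wpDl.
have e0 : 0 < `|f x| / (C + 1) by rewrite divr_gt0// normr_gt0.
have : closure S x by rewrite ST.
move=> /(_ _ (nbhsx_ballx x _ e0))[z [Sz]]; rewrite -ball_normE /= ltr_pdivlMr// => xz.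
have : `|f x| < `|f x|.
  apply: le_lt_trans xz.
  have -> : f x = f (x - z).
    by rewrite -[x - z]addrC -scaleN1r flin (fS _ Sz) scaler0 add0r.
  by rewrite mulrC (le_trans (fC _))// ler_wpM2r// lerDl.
by rewrite ltxx.
Qed.

End Annihilators.

Section NestOrder.
Context {K : numFieldType} {X : normedModType K} (N : nest X).
Implicit Types L M P : set X.

Lemma nest_le_or_lt L M : N L -> N M -> L `<=` M \/ M `<` L.
Proof.
move=> NL NM; have [|LM] := pselect (L `<=` M); first by left.
by right; split=> //; have [] := nest_chain NL NM.
Qed.

Lemma nest_pred_mem M : N (nest_pred N M).
Proof. by apply: nest_bigjoin => L []. Qed.

Lemma nest_closed M : N M -> closed_subspace M.
Proof. exact: nest_closed_subspace. Qed.

Lemma sub_nest_pred L M : N L -> L `<` M -> L `<=` nest_pred N M.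
Proof.
move=> NL LM x Lx; apply: subset_closure; apply: sub_gen_smallest.
by exists L.
Qed.

Lemma nest_pred_sub M P : N P -> (forall L, N L -> L `<` M -> L `<=` P) ->
  nest_pred N M `<=` P.
Proof.
move=> /nest_closed[Psub Pc] MP; rewrite [X in _ `<=` X](closure_id P).1//.
apply: closure_subset; apply: smallest_sub => // x [L [NL LM] Lx].
exact: MP Lx.
Qed.

Lemma nest_pred_le M : N M -> nest_pred N M `<=` M.
Proof. by move=> NM; apply: nest_pred_sub => // L _ []. Qed.

(** Let [P] be the intersection of all members strictly above [M]. If [P = M],
    use that [L_-] is inside [L]; otherwise [P] covers [M], so [P_-] is inside
    [M]. *)
Lemma mem_nest_of_preds M z : N M ->
  (forall L, N L -> M `<` L -> nest_pred N L z) -> M z.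
Proof.
move=> NM zL.
pose P := \bigcap_(L in [set L | N L /\ M `<` L]) L.
have NP : N P by apply: nest_bigcap => L [].
have [PM|MP] := nest_le_or_lt NP NM.
  by apply: PM => L [NL ML]; apply: (nest_pred_le NL); exact: zL.
have : nest_pred N P `<=` M; last by apply; exact: zL.
apply: nest_pred_sub => // L NL LP.
have [//|ML] := nest_le_or_lt NL NM.
by case: LP => _; case=> x; exact.
Qed.

(** The functionals that kill the predecessor of some nonzero member therefore
    separate points; these are the functionals seen by rank-one members of the
    algebra. *)
Lemma nest_preds_eq0 z :
  (forall P, N P -> [set 0] `<` P -> nest_pred N P z) -> z = 0.
Proof. exact: mem_nest_of_preds (nest0 N). Qed.

Lemma nonzero_mem P : [set 0] `<` P -> exists2 x, P x & x <> 0.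
Proof. by move=> [_ /existsNP[x /not_implyP[Px x0]]]; exists x. Qed.

Lemma set0_proper P x : N P -> P x -> x <> 0 -> [set 0] `<` P.
Proof.
move=> /nest_closed[[P0 _] _] Px x0; split=> [_ ->//|P0']; exact: x0 (P0' _ Px).
Qed.

Lemma nest_meet_nonzero P L y : N P -> N L -> [set 0] `<` P -> L y -> y <> 0 ->
  exists x, [/\ P x, L x & x <> 0].
Proof.
move=> NP NL P0 Ly y0; have [PL|[LP _]] := nest_le_or_lt NP NL.
  by have [x Px x0] := nonzero_mem P0; exists x; split => //; exact: PL.
by exists y; split=> //; exact: LP.
Qed.

(** The members on which a derivation can be implemented by hand: some nonzero
    functional kills the predecessor, so all vectors of [L] occur in rank-one
    operators with a common functional. *)
Definition local_domain L : Prop := N L /\ nest_pred N L <> setT.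

(** Either [X] itself qualifies, or [X] is the closed span of the smaller members,
    all of which qualify; a union of a chain of subspaces is a subspace. *)
Lemma local_domain_dense (v : X) : v <> 0 ->
  closure [set x | exists2 L, local_domain L & L x] = setT.
Proof.
move=> v0; apply/seteqP; split=> // x _.
have [XX|XX] := pselect (nest_pred N setT = setT); last first.
  by apply: subset_closure; exists setT => //; split=> //; exact: nestT.
have : nest_pred N setT x by rewrite XX.
apply: closure_subset; apply: smallest_sub; last first.
  move=> y [L [NL LT] Ly]; exists L => //; split=> // LE.
  by case: LT => _; apply; rewrite -LE; exact: nest_pred_le.
have D0 : local_domain [set 0].
  split; first exact: nest0.
  move=> E; apply: v0; have : nest_pred N [set 0] v by rewrite E.
  exact: (nest_pred_le (nest0 N)).
split; first by exists [set 0].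
move=> k y z [L [NL LT] Ly] [M [NM MT] Mz].
have [LM|[ML _]] := nest_le_or_lt NL NM.
- exists M => //; have [[_ Mlin] _] := nest_closed NM.
  by apply: Mlin => //; exact: LM.
- exists L => //; have [[_ Llin] _] := nest_closed NL.
  by apply: Llin => //; exact: ML.
Qed.

(** Total in [f] and [x], with value [0] when the operator is not in the algebra,
    so that linearity in [x] can be stated without membership proofs. *)
Definition rank_one (f : X -> K) (x : X) : nest_alg N :=
  insubd 0 (fun y => f y *: x).

(** A member [M] of the nest contains [P], hence the range, or lies strictly below
    [P], hence in the kernel. *)
Lemma rank_oneE P f x y : N P -> P x -> annihilator (nest_pred N P) f ->
  rank_one f x y = f y *: x.
Proof.
move=> NP Px fP; have [flin [c fc] f0] := fP.
rewrite /rank_one /insubd insubT//=.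
apply/in_nest_algP; split; first split.
- by move=> k a b; rewrite flin scalerDl scalerA.
- exists (c * `|x|) => a; rewrite normrZ mulrAC ler_wpM2r//.
- move=> M NM a Ma; have [[M0 Mlin] _] := nest_closed NM.
  have [PM|MP] := nest_le_or_lt NP NM.
    by have := Mlin (f a) x 0 (PM _ Px) M0; rewrite addr0.
  by rewrite f0 ?scale0r//; exact: sub_nest_pred Ma.
Qed.

End NestOrder.

(** * Local implementation and automatic continuity *)

Lemma le0_small (K : numFieldType) (k B : K) : 0 <= B ->
  (forall e, 0 < e -> k <= B * e) -> k <= 0.
Proof.
move=> B0 small; apply/ler_addgt0Pr => e e0; rewrite add0r.
have B1 : 0 < B + 1 by rewrite ltr_wpDl.
apply: le_trans (small _ (divr_gt0 e0 B1)) _.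
by rewrite mulrCA ger_pMr// ler_pdivrMr// mul1r lerDl.
Qed.

Section LocalImplementation.
Context {R : realType} {K : numFieldType}.
Context {inj : {rmorphism R -> K}} {re : K -> R} (KP : real_form inj re).
Context {X : completeNormedModType K} (N : nest X).
Implicit Types (L M P : set X) (a b : nest_alg N).

Lemma annihilator_norming L v : closed_subspace L -> ~ L v ->
  exists (f : X -> K) (x0 : X), [/\ annihilator L f, L (v - x0), f x0 = 1 &
    forall x, `|f x| * `|x0| <= 2 * `|x|].
Proof.
move=> Lc Lv.
have [f [x0 [flin fL vx0 fx0 fle]]] := closed_subspace_separation KP Lc Lv.
exists f, x0; split=> //; split=> //; exists (2 / `|x0|) => x.
have x00 : 0 < `|x0|.
  rewrite normr_gt0; apply: contra_eq_neq fx0 => ->.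
  have := flin (- 1) 0 0; rewrite scaler0 addr0 mulN1r addNr => ->.
  by rewrite eq_sym oner_neq0.
by rewrite mulrAC ler_pdivlMr.
Qed.

Lemma annihilator_separation L v : closed_subspace L -> ~ L v ->
  exists2 f, annihilator L f & f v = 1.
Proof.
move=> Lc Lv; have [f [x0 [fL vx0 fx0 _]]] := annihilator_norming Lc Lv.
exists f => //; rewrite -(subrK x0 v) -fx0.
have [flin _ f0] := fL; have := flin 1 (v - x0) x0.
by rewrite scale1r mul1r (f0 _ vx0) add0r.
Qed.

Lemma nest_pred_annihilated P z :
  (forall g, annihilator (nest_pred N P) g -> g z = 0) -> nest_pred N P z.
Proof.
move=> gz; apply: contrapT => Pz.
have [g gP gz1] := annihilator_separation (nest_closed (nest_pred_mem N P)) Pz.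
by have := gz g gP; rewrite gz1 => /eqP; rewrite oner_eq0.
Qed.

Context (D : {linear nest_alg N -> nest_alg N}).
Context (DM : forall a b, D (a * b) = D a * b + a * D b).

Definition linear_on L (T : X -> X) : Prop :=
  forall (k : K) x y, L x -> L y -> T (k *: x + y) = k *: T x + T y.

Definition implements_on L (T : X -> X) : Prop :=
  linear_on L T /\ forall a x, L x -> D a x = T (a x) - a (T x).

(** Boundedness by [C] for the operator norm, phrased with bounds [c] of [a]
    so that it makes sense over [K]. *)
Definition derivation_bound (C : K) : Prop :=
  forall a c, 0 <= c -> (forall x, `|a x| <= c * `|x|) ->
    forall x, `|D a x| <= C * c * `|x|.

Lemma nest_alg_sub (a : nest_alg N) P x : N P -> P x -> P (a x).
Proof. by move=> NP; have /in_nest_algP[_] := nest_opP a; exact. Qed.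

(** With [f] killing [L_-] and [f x0 = 1], put [T x = D (x ⊗ f) x0] and evaluate
    [D (a * (x ⊗ f)) = D a * (x ⊗ f) + a * D (x ⊗ f)] at [x0]. *)
Lemma local_implementation L : local_domain N L -> exists T,
  implements_on L T /\ forall C, derivation_bound C ->
    forall x, L x -> `|T x| <= C * 2 * `|x|.
Proof.
move=> [NL LT].
have [v Lv] : exists v, ~ nest_pred N L v.
  by apply/existsNP => LT'; apply: LT; apply/seteqP; split.
have [f [x0 [fL _ fx0 fle]]] :=
  annihilator_norming (nest_closed (nest_pred_mem N L)) Lv.
have [[L0 Llin] _] := nest_closed NL.
have x00 : 0 < `|x0|.
  rewrite normr_gt0; apply: contra_eq_neq fx0 => ->.
  by rewrite -(subrr 0) (annihilatorB _ _ fL) subrr eq_sym oner_neq0.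
have fE x y : L x -> rank_one N f x y = f y *: x.
  by move=> Lx; exact: (rank_oneE _ NL).
exists (fun x => D (rank_one N f x) x0); split; first split.
- move=> k x y Lx Ly.
  have -> : rank_one N f (k *: x + y) = k *: rank_one N f x + rank_one N f y.
    apply: nest_alg_ext => z; rewrite nest_alg_addE nest_alg_scaleE !fE//.
      by rewrite scalerDr !scalerA mulrC.
    exact: Llin.
  by rewrite linearP.
- move=> a x Lx.
  have -> : rank_one N f (a x) = a * rank_one N f x.
    apply: nest_alg_ext => z; rewrite nest_alg_mulE !fE ?linearZ//.
    exact: nest_alg_sub.
  by rewrite DM nest_alg_addE !nest_alg_mulE fE// fx0 scale1r addrK.
- move=> C DC x Lx.
  have := DC (rank_one N f x) (2 * `|x| / `|x0|) _ _ x0.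
  rewrite -!mulrA mulVf ?gt_eqF// mulr1; apply.
    by rewrite !mulr_ge0// invr_ge0.
  move=> y; rewrite fE// normrZ.
  apply: (@le_trans _ _ (2 * `|y| / `|x0| * `|x|)).
    by rewrite ler_wpM2r// ler_pdivlMr.
  by rewrite le_eqVlt; apply/predU1P; left; field; rewrite gt_eqF.
Qed.

Lemma implements_on_rank_one L P T g x z : N P -> N L -> implements_on L T ->
  annihilator (nest_pred N P) g -> P x -> L x -> L z ->
  D (rank_one N g x) z = g z *: T x - g (T z) *: x.
Proof.
move=> NP NL [Tlin TD] gP Px Lx Lz.
have [[L0 _] _] := nest_closed NL.
have T0 : T 0 = 0.
  by have := Tlin (- 1) 0 0 L0 L0; rewrite scaler0 addr0 scaleN1r addNr.
rewrite TD// !(rank_oneE _ NP)//; congr (_ - _).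
by have := Tlin (g z) x 0 Lx L0; rewrite !addr0 T0 addr0.
Qed.

(** Suppose [a] is small and [D a] is close to [b]. For [g] killing [P_-] and a
    nonzero [x] in [P] and in the domain [L] of [y], the identity [gD] expresses
    [g (D a y) *: x] through values of [a] at fixed vectors, so it is small; hence
    [g (b y) = 0] for all such [g], which separate points, and for [y] in a dense
    subspace. *)
Lemma derivation_closable b (v : X) : v <> 0 ->
  (forall e, 0 < e -> exists a, (forall x, `|a x| <= e * `|x|) /\
    forall x, `|b x - D a x| <= e * `|x|) ->
  b = 0.
Proof.
move=> v0 bD; apply: nest_alg_ext.
have /in_nest_algP[bb _] := nest_opP b.
apply: (bounded_operator_vanish bb (local_domain_dense N v0)).
move=> y [L [NL LT] Ly].
have [y0|y0] := pselect (y = 0); first by rewrite y0 linear0.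
have [T [TP _]] := local_implementation (conj NL LT).
have [Tlin TD] := TP.
apply: nest_preds_eq0 => P NP P0.
apply: nest_pred_annihilated => g gP.
have [x [Px Lx x0]] := nest_meet_nonzero NP NL P0 Ly y0.
have [c c0 gc] := annihilator_pos gP.
have /in_nest_algP[/bounded_operator_pos[d d0 Dd] _] := nest_opP (D (rank_one N g x)).
have gD a : g (D a y) *: x =
    g (a y) *: T x - D (rank_one N g x) (a y) - g (a (T y)) *: x.
  rewrite (implements_on_rank_one NP NL TP gP Px Lx (nest_alg_sub a NL Ly)).
  by rewrite subKr TD// (annihilatorB _ _ gP) scalerBl.
have nx0 : `|x| != 0 by rewrite normr_eq0; apply/eqP.
suff : `|g (b y)| * `|x| <= 0.
  by rewrite pmulr_lle0 ?lt0r ?nx0//= normr_le0 => /eqP.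
apply: (@le0_small _ _ (c * `|y| * `|x| +
    (c * `|y| * `|T x| + d * `|y| + c * `|T y| * `|x|))).
  by rewrite !addr_ge0// !mulr_ge0.
move=> e e0; have [a [ae be]] := bD e e0; rewrite [leRHS]mulrC.
rewrite -(subrK (D a y) (b y)).
have gDD u w : g (u + w) = g u + g w.
  by have [glin _ _] := gP; have := glin 1 u w; rewrite scale1r mul1r.
rewrite -normrZ gDD scalerDl gD mulrDr (le_trans (ler_normD _ _))// lerD//.
  rewrite normrZ mulrA ler_wpM2r// (le_trans (gc _))// mulrCA ler_wpM2l//.
rewrite (le_trans (ler_normB _ _))// mulrDr lerD//; last first.
  by rewrite normrZ mulrA ler_wpM2r// (le_trans (gc _))// mulrCA ler_wpM2l.
rewrite (le_trans (ler_normB _ _))// mulrDr lerD//.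
  by rewrite normrZ mulrA ler_wpM2r// (le_trans (gc _))// mulrCA ler_wpM2l.
by rewrite (le_trans (Dd _))// mulrCA ler_wpM2l.
Qed.

Theorem derivation_bounded (v : X) : v <> 0 ->
  exists2 C, 0 <= C & derivation_bound C.
Proof.
move=> v0.
pose A := normed_nest_alg KP N.
have Dlin : linear (D : A -> A) by move=> r a b; exact: linearP.
pose DA : {linear A -> A} :=
  HB.pack (D : A -> A) (GRing.isLinear.Build R A A *:%R (D : A -> A) Dlin).
have [b bD|C C0 DC] := @closed_graph R A A DA.
  apply: (derivation_closable v0) => e e0.
  have re0 : 0 < re e by rewrite -(inj_gt0 KP) (re_ge0K KP (ltW e0)).
  have [a [ae be]] := bD _ re0; rewrite -(re_ge0K KP (ltW e0)).
  exists a; split=> x.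
    apply: le_trans (opnormP KP a x) _.
    by rewrite ler_wpM2r// (real_inj_le KP) ltW.
  apply: le_trans (opnormP KP (b - D a) x) _.
  by rewrite ler_wpM2r// (real_inj_le KP) ltW.
exists (inj C); first by rewrite (inj_ge0 KP).
move=> a c c0 ac x; apply: le_trans (opnormP KP (D a) x) _.
rewrite ler_wpM2r// -(re_ge0K KP c0) -rmorphM (real_inj_le KP).
apply: le_trans (DC a) _; rewrite ler_wpM2l//.
by apply: opnorm_le; rewrite ?(re_ge0K KP)// -(inj_ge0 KP) (re_ge0K KP).
Qed.

End LocalImplementation.

(** * Extension of bounded relations *)

Section Extension.
Context {K : numFieldType} {X Y : completeNormedModType K}.

(** The gluing produces a graph on a dense subspace rather than a function, hence
    the relational form. The value at [x] is the limit of the values at points of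
    the domain near [x]; the estimate in [TP] characterises it and yields
    linearity. *)
Lemma bounded_relation_extension (G : X -> Y -> Prop) (C : K) : 0 <= C ->
  (forall k z w z' w', G z w -> G z' w' -> G (k *: z + z') (k *: w + w')) ->
  (forall z w, G z w -> `|w| <= C * `|z|) ->
  closure [set z | exists w, G z w] = setT ->
  exists T : X -> Y, [/\ linear T, forall x, `|T x| <= C * `|x| &
    forall z w, G z w -> T z = w].
Proof.
move=> C0 Glin GC Gdense.
have approx x e : 0 < e -> exists z w, G z w /\ `|x - z| < e.
  move=> e0; have : closure [set z | exists w, G z w] x by rewrite Gdense.
  move=> /(_ _ (nbhsx_ballx x _ e0))[z [[w Gzw]]]; rewrite -ball_normE => xz.
  by exists z, w.
have GB z w z' w' : G z w -> G z' w' -> `|w - w'| <= C * `|z - z'|.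
  move=> Gz Gz'; have := GC _ _ (Glin (- 1) _ _ _ _ Gz' Gz).
  by rewrite !scaleN1r ![- _ + _]addrC.
have /choice[T TP] x : exists y, forall z w, G z w -> `|y - w| <= C * `|x - z|.
  pose B e := [set w | exists2 z, G z w & `|x - z| < e].
  pose F := filter_from [set e : K | 0 < e] B.
  have FF : ProperFilter F.
    apply: filter_from_proper; last first.
      by move=> e /= /(approx x)[z [w [Gzw xz]]]; exists w, z.
    apply: filter_from_filter; first by exists 1 => /=.
    move=> e1 e2 /= e10 e20; have e120 := addr_gt0 e10 e20.
    (* A lower bound of [e1] and [e2] by field operations, the order of [K] being
       partial. *)
    exists (e1 * e2 / (e1 + e2)); first by rewrite /= divr_gt0// mulr_gt0.
    move=> w [z Gzw xz]; split; exists z => //; apply: lt_trans xz _.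
      by rewrite -mulrA gtr_pMr// ltr_pdivrMr// mul1r ltrDr.
    by rewrite mulrAC gtr_pMl// ltr_pdivrMr// mul1r ltrDl.
  have /cauchy_cvg/cvg_ex[y Fy] : cauchy F.
    apply: cauchy_exP => e e0.
    have C1 : 0 < C *+ 2 + 1 by rewrite ltr_wpDl// mulrn_wge0.
    pose d := e / (C *+ 2 + 1).
    have d0 : 0 < d by rewrite divr_gt0.
    have [z [w [Gzw xz]]] := approx x _ d0; exists w, d => // w' [z' Gz'w' xz'].
    rewrite -ball_normE /=; apply: le_lt_trans (GB _ _ _ _ Gzw Gz'w') _.
    have zz' : `|z - z'| <= d + d.
      rewrite -(subrKA x) (le_trans (ler_normD _ _))// lerD// ltW//.
      by rewrite distrC.
    apply: le_lt_trans (ler_wpM2l C0 zz') _.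
    rewrite -mulr2n mulrnAr -mulrnAl /d mulrA ltr_pdivrMr// mulrC ltr_pM2l//.
    by rewrite ltrDl.
  exists y => z w Gzw; apply/ler_addgt0Pr => e e0.
  have C1 : 0 < C + 1 by rewrite ltr_wpDl.
  apply: (@cvg_dist_le _ _ _ F _ id) => //.
  exists (e / (C + 1)); first by rewrite /= divr_gt0.
  move=> w' [z' Gz'w' xz'].
  apply: le_trans (GB _ _ _ _ Gz'w' Gzw) _.
  have zz' : `|z' - z| <= `|x - z| + e / (C + 1).
    rewrite -(subrKA x) (le_trans (ler_normD _ _))// addrC lerD// ltW//.
    by rewrite distrC.
  apply: le_trans (ler_wpM2l C0 zz') _; rewrite mulrDr lerD2l.
  by rewrite mulrCA ger_pMr// ler_pdivrMr// mul1r lerDl.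
exists T; split.
- move=> k x y; apply/eqP; rewrite -subr_eq0 -normr_eq0 eq_le normr_ge0 andbT.
  apply: (@le0_small _ _ (C * (`|k| + 1) *+ 2)).
    by rewrite mulrn_wge0// mulr_ge0// addr_ge0.
  move=> e e0; have [z [w [Gzw xz]]] := approx x e e0.
  have [z' [w' [Gzw' xz']]] := approx y e e0.
  have Gk := Glin k _ _ _ _ Gzw Gzw'.
  rewrite -(subrKA (k *: w + w')) mulr2n mulrDl.
  rewrite (le_trans (ler_normD _ _))// lerD//.
    apply: le_trans (TP _ _ _ Gk) _; rewrite -mulrA ler_wpM2l//.
    rewrite opprD addrACA -scalerBr (le_trans (ler_normD _ _))//.
    by rewrite normrZ mulrDl mul1r lerD ?ler_wpM2l// ltW.
  rewrite distrC opprD addrACA -scalerBr (le_trans (ler_normD _ _))//.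
  rewrite normrZ mulrDr mulr1 mulrDl lerD//.
    rewrite (mulrC C) -mulrA ler_wpM2l// (le_trans (TP _ _ _ Gzw))//.
    by rewrite ler_wpM2l// ltW.
  by rewrite (le_trans (TP _ _ _ Gzw'))// ler_wpM2l// ltW.
- move=> x; have [z [w [Gzw _]]] := approx 0 1 ltr01.
  have := TP x _ _ (Glin (- 1) _ _ _ _ Gzw Gzw).
  by rewrite !scaleN1r !addNr !subr0.
- move=> z w Gzw; apply/eqP; rewrite -subr_eq0 -normr_eq0 eq_le normr_ge0 andbT.
  by have := TP z _ _ Gzw; rewrite subrr normr0 mulr0.
Qed.
End Extension.

(** * Gluing the local implementations *)

Section BoundedOperators.
Context {K : numFieldType} {X : normedModType K}.

Lemma bounded_operator_comp (f g : X -> X) :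
  bounded_operator f -> bounded_operator g -> bounded_operator (f \o g).
Proof.
move=> fb [glin [c gc]]; have [d d0 fd] := bounded_operator_pos fb.
have [flin _] := fb; split; first by move=> k x y /=; rewrite glin flin.
exists (d * c) => x /=; apply: le_trans (fd _) _.
by rewrite -mulrA ler_wpM2l.
Qed.

Lemma bounded_operator_sub (f g : X -> X) :
  bounded_operator f -> bounded_operator g -> bounded_operator (f \- g).
Proof.
move=> [flin [d fd]] [glin [c gc]]; split.
  by move=> k x y /=; rewrite flin glin scalerBr opprD addrACA.
exists (d + c) => x /=; rewrite mulrDl (le_trans (ler_normB _ _))//.
exact: lerD.
Qed.

Lemma nest_alg_bounded (N : nest X) (a : nest_alg N) : bounded_operator a.
Proof. by have /in_nest_algP[] := nest_opP a. Qed.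

End BoundedOperators.

(** [L] is a starting domain and [P] a nonzero member inside it whose
    predecessor does not contain [L]; such a [P] is [L] itself or, when [L] is its
    own predecessor, any nonzero member strictly below. *)
Lemma nest_pivot (K : numFieldType) (X : normedModType K) (N : nest X) (v : X) :
  v <> 0 -> exists L P y, [/\ local_domain N L, N P, [set 0] `<` P, P `<=` L &
    L y /\ ~ nest_pred N P y].
Proof.
move=> v0.
have [L LP [x Lx x0]] : exists2 L, local_domain N L & exists2 x, L x & x <> 0.
  have v_gt0 : 0 < `|v| by rewrite normr_gt0; apply/eqP.
  have : closure [set x | exists2 L, local_domain N L & L x] v.
    by rewrite (local_domain_dense N v0).
  move=> /(_ _ (nbhsx_ballx v _ v_gt0))[x [[L LP Lx]]]; rewrite -ball_normE /= => vx.
  by exists L => //; exists x => // x0; move: vx; rewrite x0 subr0 ltxx.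
have [NL LT] := LP.
have [LL|/existsNP[y /not_implyP[Ly yL]]] := pselect (L `<=` nest_pred N L); last first.
  by exists L, L, y; split=> //; exact: set0_proper NL Lx x0.
have [P [NP P0 PL]] : exists P, [/\ N P, [set 0] `<` P & P `<` L].
  apply: contrapT => nP; apply: x0.
  suff : nest_pred N L `<=` [set 0] by apply; exact: LL.
  apply: nest_pred_sub => [|P NP PL]; first exact: nest0.
  have [//|P0] := nest_le_or_lt NP (nest0 N).
  by case: nP; exists P.
have [PsubL /existsNP[y /not_implyP[Ly Py]]] := PL.
exists L, P, y; split=> //; split=> // /(nest_pred_le NP); exact: Py.
Qed.

Section Gluing.
Context {R : realType} {K : numFieldType}.
Context {inj : {rmorphism R -> K}} {re : K -> R} (KP : real_form inj re).
Context {X : completeNormedModType K} (N : nest X).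
Implicit Types (L M P : set X) (a b : nest_alg N).

(** Commuting with [x ⊗ g] gives [g y *: S x = g (S y) *: x]. With [g0] and [y0]
    this kills [S] on [P]; then, for a nonzero [x] in [P] and any other [g] with
    [x ⊗ g] in the algebra, it gives [g (S y) = 0], and these [g] separate
    points. *)
Lemma commutant_vanish L P (S : X -> X) y0 g0 : N L -> N P -> [set 0] `<` P ->
  P `<=` L -> linear_on L S -> (forall a x, L x -> S (a x) = a (S x)) ->
  L y0 -> annihilator (nest_pred N P) g0 -> g0 y0 = 1 -> g0 (S y0) = 0 ->
  forall x, L x -> S x = 0.
Proof.
move=> NL NP P0 PL Slin SA Ly0 g0P g0y0 g0S x Lx.
have [[L0 _] _] := nest_closed NL.
have SE Q g z y : N Q -> annihilator (nest_pred N Q) g -> Q z -> L z -> L y ->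
    g y *: S z = g (S y) *: z.
  move=> NQ gQ Qz Lz Ly; have := SA (rank_one N g z) y Ly.
  rewrite !(rank_oneE _ NQ)// => <-.
  have S0 : S 0 = 0.
    by have := Slin (- 1) 0 0 L0 L0; rewrite scaler0 addr0 scaleN1r addNr.
  by have := Slin (g y) z 0 Lz L0; rewrite !addr0 S0 addr0.
have SP z : P z -> S z = 0.
  move=> Pz; have := SE _ _ _ _ NP g0P Pz (PL _ Pz) Ly0.
  by rewrite g0y0 g0S scale1r scale0r.
apply: nest_preds_eq0 => Q NQ Q0; apply: (nest_pred_annihilated KP) => g gQ.
have [p Pp p0] := nonzero_mem P0.
have [z [Qz Pz z0]] := nest_meet_nonzero NQ NP Q0 Pp p0.
have := SE _ _ _ _ NQ gQ Qz (PL _ Pz) Lx.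
rewrite SP// scaler0 => /esym/eqP; rewrite scaler_eq0 => /orP[/eqP//|/eqP].
by move=> /z0.
Qed.

Context (D : {linear nest_alg N -> nest_alg N}).
Context (DM : forall a b, D (a * b) = D a * b + a * D b).

(** The normalisation [g (T y0) = 0] is achieved by subtracting a scalar from [T],
    which does not change [T a - a T]. *)
Lemma global_implementation (v : X) : v <> 0 -> exists T : X -> X,
  bounded_operator T /\ forall a x, D a x = T (a x) - a (T x).
Proof.
move=> v0.
have [C C0 DC] := derivation_bounded KP DM v0.
have [L0 [P [y0 [L0P NP P0 PL0 [Ly0 Py0]]]]] := nest_pivot N v0.
have [g gP gy0] := annihilator_separation KP (nest_closed (nest_pred_mem N P)) Py0.
have [c c0 gc] := annihilator_pos gP.
pose B := C * 2 + c * (C * 2 * `|y0|).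
pose normalized L T := [/\ implements_on D L T, g (T y0) = 0 &
  forall x, L x -> `|T x| <= B * `|x|].
have norm_ex L : local_domain N L -> L0 `<=` L -> exists T, normalized L T.
  move=> LP L0L; have [T [[Tlin TD] TC]] := local_implementation KP DM LP.
  have Ly0' := L0L _ Ly0.
  exists (fun x => T x - g (T y0) *: x); split; first split.
  - move=> k x y Lx Ly; rewrite Tlin// scalerDr scalerBr !scalerA (mulrC k).
    by rewrite opprD addrACA.
  - by move=> a x Lx; rewrite TD// (linearB a) (linearZ_LR a) /= opprB subrKA.
  - rewrite (annihilatorB _ _ gP); have [glin _ _] := gP.
    have g0 : g 0 = 0 by rewrite -(subrr 0) (annihilatorB _ _ gP) subrr.
    have := glin (g (T y0)) y0 0; rewrite !addr0 g0 addr0 gy0 mulr1 => ->.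
    by rewrite subrr.
  - move=> x Lx; rewrite (le_trans (ler_normB _ _))// mulrDl lerD//.
      exact: TC.
    rewrite normrZ ler_wpM2r// (le_trans (gc _))// ler_wpM2l//.
    exact: TC.
have consistent L L' T T' : local_domain N L -> L0 `<=` L -> L `<=` L' ->
    normalized L T -> normalized L' T' -> forall x, L x -> T' x = T x.
  move=> [NL _] L0L LL' [[Tlin TD] gT _] [[Tlin' TD'] gT' _] x Lx.
  apply/eqP; rewrite -subr_eq0; apply/eqP.
  apply: (@commutant_vanish L P (T' \- T) y0 g) => //=.
  - exact: subset_trans L0L.
  - move=> k z y Lz Ly /=; rewrite Tlin// Tlin'; [|exact: LL'..].
    by rewrite scalerBr opprD addrACA.
  - move=> a z Lz; rewrite linearB /=.
    have TT' := TD' a _ (LL' _ Lz); rewrite (TD _ _ Lz) in TT'.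
    apply/eqP; rewrite subr_eq -(subrK (a (T' z)) (T' (a z))) -TT'; apply/eqP.
    by rewrite addrAC [RHS]addrAC (addrC (T (a z))).
  - exact: L0L.
  - by rewrite (annihilatorB _ _ gP) gT gT' subrr.
pose G z w := exists L T, [/\ local_domain N L, L0 `<=` L, normalized L T, L z & w = T z].
have Gdense : closure [set z | exists w, G z w] = setT.
  apply/seteqP; split=> // x _.
  have : closure [set x | exists2 L, local_domain N L & L x] x.
    by rewrite (local_domain_dense N v0).
  apply: closure_subset => z [L LP Lz].
  have [NL _] := LP; have [NL0 _] := L0P.
  have [L' [LP' L0L' L'z]] : exists L', [/\ local_domain N L', L0 `<=` L' & L' z].
    have [LL0|[L0L _]] := nest_le_or_lt NL NL0; last by exists L.
    by exists L0; split=> //; exact: LL0.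
  by have [T TP] := norm_ex _ LP' L0L'; exists (T z), L', T.
have B0 : 0 <= B by rewrite addr_ge0// !mulr_ge0.
have [|||T [Tlin TB TG]] := @bounded_relation_extension K X X G B B0.
- move=> k z w z' w' [L [T [LP L0L TP Lz ->]]] [L' [T' [LP' L0L' TP' Lz' ->]]].
  have [NL _] := LP; have [NL' _] := LP'.
  have [LL'|[L'L _]] := nest_le_or_lt NL NL'.
    exists L', T'; have [[Tlin' _] _ _] := TP'.
    have [[_ L'lin] _] := nest_closed NL'.
    split=> //; first by apply: L'lin => //; exact: LL'.
    by rewrite -(consistent _ _ _ _ LP L0L LL' TP TP' _ Lz) Tlin'//; exact: LL'.
  exists L, T; have [[Tlin _] _ _] := TP.
  have [[_ Llin] _] := nest_closed NL.
  split=> //; first by apply: Llin => //; exact: L'L.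
  by rewrite -(consistent _ _ _ _ LP' L0L' L'L TP' TP _ Lz') Tlin//; exact: L'L.
- by move=> z w [L [T [LP L0L [_ _ TB] Lz ->]]]; exact: TB.
- exact: Gdense.
have Tb : bounded_operator T by split=> //; exists B.
exists T; split=> // a x.
pose f := (D a : X -> X) \- ((T \o a) \- (a \o T)).
suff : f x = 0 by move/eqP; rewrite subr_eq0 => /eqP.
apply: (bounded_operator_vanish _ Gdense).
  apply: bounded_operator_sub; first exact: nest_alg_bounded.
  apply: bounded_operator_sub; apply: bounded_operator_comp => //;
    exact: nest_alg_bounded.
move=> z [w [L [T' [LP L0L TP Lz _]]]].
have [[_ TD'] _ _] := TP.
have Taz y : L y -> T y = T' y by move=> Ly; apply: TG; exists L, T'.
have [NL _] := LP.
rewrite /f /= TD'// !Taz ?subrr//.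
exact: nest_alg_sub.
Qed.

(** For [y] in [M] and [x] in [L] but not in [M], with [g] killing [L_-] and hence
    [y], applying [D (x ⊗ g)] to [y] gives [- g (T y) *: x]. It lies in [M], so
    [g (T y) = 0]. *)
Lemma implementation_mem (T : X -> X) : bounded_operator T ->
  (forall a x, D a x = T (a x) - a (T x)) -> T \in in_nest_alg N.
Proof.
move=> Tb TD; apply/in_nest_algP; split=> // M NM y My.
apply: (mem_nest_of_preds NM) => L NL ML.
apply: (nest_pred_annihilated KP) => g gL.
have [_ /existsNP[x /not_implyP[Lx Mx]]] := ML.
have Dy := nest_alg_sub (D (rank_one N g x)) NM My.
have [_ _ /(_ y (sub_nest_pred NM ML My)) gy0] := gL.
move: Dy; rewrite TD !(rank_oneE _ NL)// gy0 scale0r.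
have [Tlin _] := Tb; have [[M0 Mlin] _] := nest_closed NM.
have -> : T 0 = 0.
  by have := Tlin (- 1) 0 0; rewrite scaler0 addr0 scaleN1r addNr.
rewrite sub0r => Mgx; apply: contrapT => /eqP gTy; apply: Mx.
have := Mlin (- (g (T y))^-1) _ _ Mgx M0.
by rewrite addr0 scaleNr scalerN opprK scalerK.
Qed.

Theorem derivation_inner (v : X) : v <> 0 ->
  exists t : nest_alg N, forall a, D a = t * a - a * t.
Proof.
move=> v0; have [T [Tb TD]] := global_implementation v0.
by exists (NestAlg (implementation_mem Tb TD)) => a; apply: nest_alg_ext => x; rewrite TD.
Qed.

End Gluing.

(** * Ternary derivations *)

Section TernaryDerivationsOfRings.
Context {A : pzRingType} (gamma delta tau : A -> A).
Context (ter : forall a b, gamma (a * b) = delta a * b + a * tau b).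
Implicit Types a b t : A.

Let deltaE a : delta a = gamma a - a * tau 1.
Proof. by have := ter a 1; rewrite !mulr1 => ->; rewrite addrK. Qed.

Let tauE a : tau a = gamma a - delta 1 * a.
Proof.
by have := ter 1 a; rewrite !mul1r => ->; rewrite addrC addrA addNr add0r.
Qed.

(** Setting [a] or [b] to [1] in the ternary rule expresses [delta] and [tau]
    through [gamma]. *)
Lemma ternary_derivation_part a b : delta (a * b) - delta 1 * (a * b) =
  (delta a - delta 1 * a) * b + a * (delta b - delta 1 * b).
Proof.
have tau_b : tau b = delta b - delta 1 * b + b * tau 1.
  by rewrite tauE (deltaE b) addrAC subrK.
have -> : delta (a * b) = delta a * b + a * (delta b - delta 1 * b).
  by rewrite (deltaE (a * b)) ter tau_b mulrDr addrA mulrA addrK.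
by rewrite mulrBl mulrA addrAC.
Qed.

Lemma ternary_derivation_of_commutator t :
  (forall a, delta a - delta 1 * a = t * a - a * t) ->
  [/\ forall a, gamma a = (delta 1 + t) * a + a * (tau 1 - t),
      forall a, delta a = (delta 1 + t) * a + a * - t &
      forall a, tau a = - (- t * a) + a * (tau 1 - t)].
Proof.
move=> tP.
have deltat a : delta a = (delta 1 + t) * a + a * - t.
  by rewrite -[LHS](subrK (delta 1 * a)) tP mulrDl mulrN addrC addrA.
have gammat a : gamma a = (delta 1 + t) * a + a * (tau 1 - t).
  rewrite -[gamma a](subrK (a * tau 1)) -deltaE deltat.
  by rewrite mulrDr -addrA (addrC (a * - t)).
split=> // a.
rewrite tauE gammat mulNr opprK mulrDl -(addrA (delta 1 * a)).
by rewrite (addrC (delta 1 * a)) addrK.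
Qed.

End TernaryDerivationsOfRings.

Theorem corollary1p3 (R : realType) (K : numFieldType)
    (scalars : real_or_complex R K)
    (X : completeNormedModType K) (dimX : dim_ge X 2)
    (N : nest X)
    (compl : forall M : set X, N M -> nest_pred N M = M -> complemented M)
    (gamma delta tau : {linear nest_alg N -> nest_alg N}) :
  ternary_derivation nest_alg_mul gamma delta tau ->
  inner_ternary_derivation nest_alg_mul gamma delta tau.
Proof.
have [inj [re KP]] := real_or_complex_form scalars.
have [w wP] := dimX.
have w0 : w ord0 <> 0.
  move=> w0; have := wP (fun i => (i == ord0)%:R) _ ord0.
  rewrite eqxx big1 => [/(_ erefl)/eqP|i _]; first by rewrite oner_eq0.
  by have [->|_] := eqVneq i ord0; rewrite ?w0 ?scaler0 ?scale0r.
move=> ter.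
have terE (a b : nest_alg N) : gamma (a * b) = delta a * b + a * tau b := ter a b.
pose d (a : nest_alg N) := delta a - delta 1 * a.
have dlin : linear d.
  move=> k a b; rewrite /d linearP mulrDr -nest_alg_scalerAr opprD addrACA.
  by rewrite scalerBr.
pose D : {linear nest_alg N -> nest_alg N} :=
  HB.pack d (GRing.isLinear.Build K _ _ *:%R d dlin).
have [t tP] := derivation_inner KP (D := D) (ternary_derivation_part terE) w0.
have [gammaE deltaE tauE] := ternary_derivation_of_commutator terE tP.
by exists (delta 1 + t), (tau 1 - t), (- t); split; apply/funext.
Qed.
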